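(* Let $u$ be the (sufficiently smooth) solution of $u'(t)+Au(t)+Bu(t)=f(t)$, $t\in(0,T]$, $u(0)=u^0$, let $U^n$, $n=2,\dots,N$, be the solution of the variable step-size BDF2 scheme $\bar\partial_B^2U^n+AU^n+BU^n=f^n$ ($n=2,\dots,N$) with starting approximations $U^0,U^1$, and let $e^n=u(t^n)-U^n$. Let $r_{\max}\le R$ with $1<R<R_0=\sqrt2+1\approx2.414$. If $e^0=0$ and there exists a constant $c_1$ such that $k_{\max}$ satisfies $(4+2\sqrt2)\gamma^2k_{\max}\le c_1<1$, then for $n=2,3,\dots,N$ $$\|e\|^2_{l^2(t^2,t^n;H,H)}+\|e\|^2_{l^\infty(t^2,t^n;V)}\le C\Big(k_{\max}^4t^n+\frac{k_2}{k_1^2}|e^1|^2+\|e^1\|^2\Big),$$ where $C$ depends on $t^n$ and the constants $\gamma,c_1,c_4$.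
   Context: Let $(H,(\cdot,\cdot))$ be a Hilbert space with norm $|\cdot|$, and $A:D(A)\to H$ a positive definite, self-adjoint, linear operator with $D(A)$ dense in $H$. Let $V=D(A^{1/2})$ with norm $\|v\|=|A^{1/2}v|=(Av,v)^{1/2}$, and let $V^*$ be its dual, $V\subset H\subset V^*$, with norm $\|v\|_*=|A^{-1/2}v|$; $(\cdot,\cdot)$ also denotes the duality pairing between $V^*$ and $V$. $B$ is a linear operator with $|Bu|\le\gamma(t)\|u\|$ for all $u\in V$, $t\in J:=(0,T]$, where $\gamma:J\to\mathbb R$ is a smooth nonnegative function, and (without argument) $\gamma:=\max_{t\in J}\gamma(t)$. $f:[0,T]\to H$. Partition: $N\ge2$, $0=t^0<t^1<\dots<t^N=T$, $k_n=t^n-t^{n-1}$, $r_n=k_n/k_{n-1}$ and $s_n=r_n/(1+r_n)=k_n/(k_n+k_{n-1})$ for $n\ge2$; $k_{\max}=\max_{2\le n\le N}k_n$, $r_{\max}=\max_{2\le n\le N}r_n$; $f^n=f(t^n)$. Difference operators: $\bar\partial U^n=(U^n-U^{n-1})/k_n$ and $\bar\partial_B^2U^n=(1+s_n)\bar\partial U^n-s_n\bar\partial U^{n-1}$. The scheme is understood in variational form: $(\bar\partial_B^2U^n,v)+(AU^n,v)+(BU^n,v)=(f^n,v)$ for all $v\in V$, with $U^n\in V$; $U^1\in V$. Consistency error: $d_2^n=\bar\partial_B^2u(t^n)-u'(t^n)$, $n\ge2$; $c_4$ is the constant (determined by derivatives of the exact solution $u$) in the consistency bound $|d_2^n|\le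 c_4k_n^2$, $n\ge2$. The solution $u$ is assumed regular enough for this bound to hold. Norms: $\|e\|_{l^\infty(t^{n_1},t^{n_2};V)}=\max_{n_1\le j\le n_2}\|e^j\|$ and $\|e\|_{l^2(t^{n_1},t^{n_2};H,H)}=\big(\sum_{j=n_1}^{n_2-1}k_js_j|\bar\partial e^j|^2\big)^{1/2}$ (empty sums are $0$). *)

(* Defs.v *)
From HB Require Import structures.
From mathcomp Require Import all_boot all_order all_algebra.
From mathcomp Require Import all_classical all_reals all_analysis.

Set Implicit Arguments.
Unset Strict Implicit.
Unset Printing Implicit Defensive.

Import Order.TTheory GRing.Theory Num.Theory.
Import numFieldNormedType.Exports.

Local Open Scope classical_set_scope.
Local Open Scope ring_scope.

Section Operators.
Context {R : realType} {H : normedModType R}.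

(** A real inner product [ip] inducing the norm of [H]; with [H] complete this
    makes [H] a real Hilbert space. *)
Definition induces_norm (ip : {dot H for idfun}) : Prop :=
  forall x : H, `|x| ^+ 2 = ip x x.

(** A possibly unbounded operator [D(A) -> H].  The values of [op_fun] outside
    [op_dom] are meaningless and never used. *)
Record operator := Operator { op_dom : set H; op_fun :> H -> H }.

Definition linear_on (D : set H) (F : H -> H) : Prop :=
  forall (a : R) x y, D x -> D y -> F (a *: x + y) = a *: F x + F y.

Definition linear_operator (A : operator) : Prop :=
  [/\ op_dom A 0,
      forall (a : R) x y, op_dom A x -> op_dom A y -> op_dom A (a *: x + y)
    & linear_on (op_dom A) A].

(** Equality of the graphs of the operator and of its adjoint. *)
Definition self_adjoint (ip : {dot H for idfun}) (A : operator) : Prop :=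
  forall y z, (op_dom A y /\ A y = z) <->
    (forall x, op_dom A x -> ip (A x) y = ip x z).

Definition positive_definite (ip : {dot H for idfun}) (A : operator) : Prop :=
  forall x, op_dom A x -> x != 0 -> 0 < ip (A x) x.

Definition positive_semidefinite (ip : {dot H for idfun}) (A : operator) :
    Prop :=
  forall x, op_dom A x -> 0 <= ip (A x) x.

(** [S] is [A^{1/2}]: the (unique) nonnegative self-adjoint operator such that
    [S o S = A], domains included. *)
Definition is_sqrt (ip : {dot H for idfun}) (A S : operator) : Prop :=
  [/\ linear_operator S, dense (op_dom S), self_adjoint ip S,
      positive_semidefinite ip S
    & op_dom A = [set x | op_dom S x /\ op_dom S (S x)] /\
      forall x, op_dom A x -> A x = S (S x)].

(** The equation [w + A x + b = g] in [V^*], where [V = D(S)], [S = A^{1/2}],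
    [x \in V] and [w, b, g \in H].  The duality pairing [(A x, v)] of the
    extension [A : V -> V^*] is [(S x, S v)]. *)
Definition variational_eq (ip : {dot H for idfun}) (S : operator)
    (w x b g : H) : Prop :=
  op_dom S x /\
  forall v, op_dom S v -> ip w v + ip (S x) (S v) + ip b v = ip g v.

(** Derivative relative to [D]; one-sided at the end points of an interval. *)
Definition has_derivative_in (D : set R) (u : R -> H) (t : R) (du : H) :
    Prop :=
  (s - t)^-1 *: (u s - u t) @[s --> within D t^'] --> du.

Definition is_solution (ip : {dot H for idfun}) (S : operator)
    (B : R -> H -> H) (f : R -> H) (T : R) (u0 : H) (u du : R -> H) : Prop :=
  [/\ {within `[0, T], continuous u},
      forall t, 0 < t <= T -> has_derivative_in `[0, T] u t (du t),
      forall t, 0 < t <= T -> variational_eq ip S (du t) (u t) (B t (u t)) (f t)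
    & u 0 = u0].

End Operators.

Arguments operator {R} H.

(** [C^\infty] on [D], as restriction of a function [C^\infty] on an open set. *)
Definition smooth_on {R : realType} (D : set R) (g : R -> R) : Prop :=
  exists (O : set R) (h : R -> R),
    [/\ open O, D `<=` O, forall t, D t -> h t = g t
      & forall (n : nat) t, O t -> derivable (derive1n n h) t 1].

Definition is_max {R : realType} (X : set R) (m : R) : Prop :=
  X m /\ ubound X m.

Section Grid.
Context {R : realType}.
Variable t : nat -> R.

Definition time_grid (N : nat) (T : R) : Prop :=
  [/\ t 0%N = 0, t N = T & forall n, (n < N)%N -> t n < t n.+1].

Definition step (n : nat) : R := t n - t n.-1.
Definition step_ratio (n : nat) : R := step n / step n.-1.
Definition step_s (n : nat) : R := step_ratio n / (1 + step_ratio n).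

Definition step_max (N : nat) : R := \big[Num.max/0]_(2 <= n < N.+1) step n.
Definition ratio_max (N : nat) : R :=
  \big[Num.max/0]_(2 <= n < N.+1) step_ratio n.

Context {H : normedModType R}.

Definition diff1 (U : nat -> H) (n : nat) : H :=
  (step n)^-1 *: (U n - U n.-1).

Definition diffB (U : nat -> H) (n : nat) : H :=
  (1 + step_s n) *: diff1 U n - step_s n *: diff1 U n.-1.

Definition consistency_error (u du : R -> H) (n : nat) : H :=
  diffB (u \o t) n - du (t n).

Definition bdf2_solution (ip : {dot H for idfun}) (S : operator H)
    (B : R -> H -> H) (f : R -> H) (N : nat) (U : nat -> H) : Prop :=
  forall n, (2 <= n <= N)%N ->
    variational_eq ip S (diffB U n) (U n) (B (t n) (U n)) (f (t n)).

Definition norm_linf (S : operator H) (n1 n2 : nat) (e : nat -> H) : R :=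
  \big[Num.max/0]_(n1 <= j < n2.+1) `|S (e j)|.

Definition norm_l2 (n1 n2 : nat) (e : nat -> H) : R :=
  Num.sqrt (\sum_(n1 <= j < n2) step j * step_s j * `|diff1 e j| ^+ 2).

End Grid.

(* Main.v *)
(* Testing the error equation with [e n - e n.-1] and splitting
   [(d - B e, diff1 e n)] by Young's inequality with weight
   [m = (2 - sqrt 2) / 4 = (4 + 2 sqrt 2)^-1] makes the scheme dissipative as
   long as [k_n s_n <= 2 (1 - m) k_(n-1)], and this is exactly the condition
   [r_n <= 1 + sqrt 2].  The surplus [k_n s_n |diff1 e n|^2] gives the
   [l^2]-norm, the term [k_n m^-1 gamma^2 |S (e n)|^2] is absorbed because
   [(4 + 2 sqrt 2) gamma^2 k_max <= c1 < 1], and the remaining sum is handled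
   by the discrete Gronwall inequality. *)

Require Import Defs.
From HB Require Import structures.
From mathcomp Require Import all_boot all_order all_algebra.
From mathcomp Require Import all_classical all_reals all_analysis.
From mathcomp Require Import ring lra.

Set Implicit Arguments.
Unset Strict Implicit.
Unset Printing Implicit Defensive.

Import Order.TTheory GRing.Theory Num.Theory.
Import numFieldNormedType.Exports.

Local Open Scope classical_set_scope.
Local Open Scope ring_scope.

(** * Inner-product inequalities and the energy estimate of a single time step *)

Section Dot.
Context {R : realType} {H : normedModType R}.
Variable ip : {dot H for idfun}.
Hypothesis ip_norm : induces_norm ip.

Lemma dot_sym x y : ip x y = ip y x.
Proof. by rewrite hermC expr0 mul1r. Qed.

Lemma normB_sqr x y : `|x - y| ^+ 2 = `|x| ^+ 2 - 2 * ip x y + `|y| ^+ 2.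
Proof.
rewrite !ip_norm linearBl !linearBr /= (dot_sym y x); ring.
Qed.

Lemma dot_young a x y : 0 < a ->
  2 * ip x y <= a * `|x| ^+ 2 + a^-1 * `|y| ^+ 2.
Proof.
move=> a0; have := sqr_ge0 `|a *: x - y|.
rewrite normB_sqr linearZl_LR /= normrZ gtr0_norm // exprMn => h.
rewrite -subr_ge0; have -> : a * `|x| ^+ 2 + a^-1 * `|y| ^+ 2 - 2 * ip x y =
   a^-1 * (a ^+ 2 * `|x| ^+ 2 - 2 * (a * ip x y) + `|y| ^+ 2).
  by field; rewrite gt_eqF.
by rewrite mulr_ge0 // invr_ge0 ltW.
Qed.

(** Twice the tested error equation, where [w], [w'] stand for consecutive difference quotients and
    [x], [y] for [S (e n)], [S (e n.-1)]. The polarization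
    [2 (x, x - y) = |x|^2 - |y|^2 + |x - y|^2] supplies the energy difference, its last square being
    dropped. The cross term [2 k s (w, w')] costs [k s (|w|^2 + |w'|^2)], and [d] and [b] each cost
    [m k |w|^2]; this leaves [2 (1 - m) k + k s] in front of [|w|^2]. *)
Lemma energy_step (x y b d w w' : H) (k s m g : R) :
  0 < m -> 0 <= k -> 0 <= s -> `|b| <= g * `|x| ->
  ip ((1 + s) *: w - s *: w') (k *: w) + ip x (x - y) + ip b (k *: w)
    = ip d (k *: w) ->
  (2 * (1 - m) * k + k * s) * `|w| ^+ 2 - k * s * `|w'| ^+ 2
    + `|x| ^+ 2 - `|y| ^+ 2
  <= k * m^-1 * (`|d| ^+ 2 + g ^+ 2 * `|x| ^+ 2).
Proof.
move=> m0 k0 s0 bx eqn.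
rewrite !linearZr_LR /= linearBl !linearZl_LR /= (linearBr ip x) /= in eqn.
rewrite -!ip_norm (dot_sym w' w) in eqn.
have bx2 : `|b| ^+ 2 <= g ^+ 2 * `|x| ^+ 2.
  by rewrite -exprMn lerXn2r ?nnegrE // (le_trans _ bx).
have yww : k * s * (2 * ip w w') <= k * s * (`|w| ^+ 2 + `|w'| ^+ 2).
  apply: ler_wpM2l; first exact: mulr_ge0.
  by have := @dot_young 1 w w' ltr01; rewrite invr1 !mul1r.
have yd : k * (2 * ip d w) <= k * (m^-1 * `|d| ^+ 2 + m * `|w| ^+ 2).
  apply: ler_wpM2l => //.
  by have := @dot_young m^-1 d w; rewrite invr_gt0 invrK; apply.
have yb : k * (2 * ip (- b) w) <=
    k * (m^-1 * (g ^+ 2 * `|x| ^+ 2) + m * `|w| ^+ 2).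
  apply: ler_wpM2l => //.
  have := @dot_young m^-1 (- b) w; rewrite invr_gt0 invrK normrN => /(_ m0).
  move/le_trans; apply; rewrite lerD2r ler_wpM2l // invr_ge0 ltW //.
rewrite linearNl /= in yb.
have := sqr_ge0 `|x - y|; rewrite normB_sqr.
by move: eqn yww yd yb; lra.
Qed.

End Dot.

(** * Scalar recursions: summed energy, Gronwall, and the step-ratio threshold *)

Section RealSequences.
Context {R : realType}.
Implicit Types (k a E F y sigma : nat -> R).

(** The energies telescope, and the negative term [sigma n.+1 * a n] of the next step is paid by the
    [c * k n * a n] left over from step [n]. The surplus [sigma n * a n] is thus never spent and
    accumulates on the left; of the negative terms only [sigma 2 * a 1] survives. *)
Lemma energy_sum k a E F sigma (c : R) (N : nat) :
  (forall n, (1 <= n <= N)%N -> 0 <= a n) ->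
  (forall n, (2 <= n < N)%N -> sigma n.+1 <= c * k n) ->
  (forall n, (2 <= n <= N)%N ->
    (c * k n + sigma n) * a n - sigma n * a n.-1 + E n - E n.-1 <= F n) ->
  forall n, (2 <= n <= N)%N ->
    c * k n * a n + \sum_(2 <= j < n.+1) sigma j * a j + E n
    <= sigma 2 * a 1 + E 1 + \sum_(2 <= j < n.+1) F j.
Proof.
move=> a0 sk step; elim=> [//|n IH] /andP[n1 nN].
have [n2|] := ltnP 1 n; last first.
  move=> n_le1; have -> : n = 1%N by apply/eqP; rewrite eqn_leq n_le1.
  have := step 2%N; rewrite !big_nat1 /=.
  by rewrite (leq_trans _ nN) // => /(_ isT); lra.
rewrite big_nat_recr //= [in leRHS]big_nat_recr //=.
have := IH; rewrite n2 (ltnW nN) => /(_ isT).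
have := step n.+1; rewrite n1 nN => /(_ isT) /=.
have : sigma n.+1 * a n <= c * k n * a n.
  apply: ler_wpM2r; first by apply: a0; rewrite (ltnW n2) ltnW.
  by apply: sk; rewrite n2.
lra.
Qed.

(** The sum stops before [n], so no smallness of [G * k n] is required. *)
Lemma discrete_gronwall k y (D G : R) (m N : nat) :
  0 <= D -> 0 <= G -> (forall n, (m <= n <= N)%N -> 0 <= k n) ->
  (forall n, (m <= n <= N)%N -> y n <= D + G * \sum_(m <= j < n) k j * y j) ->
  forall n, (m <= n <= N)%N -> y n <= D * expR (G * \sum_(m <= j < n) k j).
Proof.
(* The induction runs on the majorant [D + G * sum] instead of [y n]: passing from [n] to [n.+1]
   multiplies its bound by at most [1 + G * k n <= expR (G * k n)]. *)
move=> D0 G0 k0 hy n mnN; apply: le_trans (hy n mnN) _; move: mnN.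
elim: n => [|n IH] /andP[mn nN].
  by rewrite !big_geq // mulr0 expR0 mulr1 addr0.
move: mn; rewrite leq_eqVlt => /predU1P[->|].
  by rewrite !big_geq // mulr0 expR0 mulr1 addr0.
rewrite ltnS => mn; rewrite !big_nat_recr //=.
have mnN : (m <= n <= N)%N by rewrite mn ltnW.
have {}IH := IH mnN; have kn := k0 n mnN.
rewrite (mulrDr G) (mulrDr G) expRD mulrA addrA.
have hexp := expR_ge1Dx (G * k n).
rewrite mulrA; apply: le_trans (ler_wpM2l (mulr_ge0 D0 (expR_ge0 _)) hexp).
have : G * k n * y n <= G * k n * (D * expR (G * \sum_(m <= j < n) k j)).
  by apply: ler_wpM2l; [exact: mulr_ge0 | exact: le_trans (hy n mnN) IH].
lra.
Qed.

Lemma sqrt2_weight : (4 + 2 * Num.sqrt 2)^-1 = (2 - Num.sqrt 2) / 4 :> R.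
Proof.
have q0 : 0 <= Num.sqrt 2 :> R by exact: sqrtr_ge0.
have q2 : Num.sqrt 2 ^+ 2 = 2 :> R by rewrite sqr_sqrtr.
apply: (@mulfI _ (4 + 2 * Num.sqrt 2)); first by rewrite gt_eqF; lra.
rewrite mulfV; last by rewrite gt_eqF; lra.
by move: q2; lra.
Qed.

(** With [r = k / k'] the claim is [r^2 <= (1 + sqrt 2 / 2) (1 + r)]. The quadratic
    [r^2 - (1 + sqrt 2 / 2) (1 + r)] has the roots [1 + sqrt 2] and [- sqrt 2 / 2], hence the
    factorization used at the end. *)
Lemma step_ratio_bound (k k' : R) :
  0 < k -> 0 < k' -> k / k' <= 1 + Num.sqrt 2 ->
  k * ((k / k') / (1 + k / k')) <= 2 * (1 - (4 + 2 * Num.sqrt 2)^-1) * k'.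
Proof.
rewrite sqrt2_weight => k0 k'0; set r := k / k' => hr.
have r0 : 0 < r by rewrite divr_gt0.
have -> : k * (r / (1 + r)) = r ^+ 2 / (1 + r) * k'.
  by rewrite -{1}(divfK (lt0r_neq0 k'0) k) -/r; ring.
have q0 : 0 <= Num.sqrt 2 :> R by exact: sqrtr_ge0.
have q2 : Num.sqrt 2 ^+ 2 = 2 :> R by rewrite sqr_sqrtr.
rewrite ler_pM2r // ler_pdivrMr; last by lra.
have : 0 <= (1 + Num.sqrt 2 - r) * (r + Num.sqrt 2 / 2) by apply: mulr_ge0; lra.
by move: q2; lra.
Qed.

End RealSequences.

(** * Elementary facts on the time grid *)

Section Grid.
Context {R : realType}.
Variables (t : nat -> R) (N : nat) (T : R).
Hypothesis grid : time_grid t N T.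

Lemma grid_le i j : (i <= j <= N)%N -> t i <= t j.
Proof.
case: grid => _ _ tS; elim: j => [|j IH].
  by rewrite leqn0 andbT => /eqP->.
case/andP; rewrite leq_eqVlt ltnS => /predU1P[-> //|ij jN].
by apply: le_trans (IH _) (ltW (tS _ jN)); rewrite ij ltnW.
Qed.

Lemma grid_in n : (1 <= n <= N)%N -> 0 < t n <= T.
Proof.
case: grid => t0 <- tS /andP[n1 nN].
rewrite (@grid_le n N) ?nN ?leqnn // andbT.
have := tS 0%N (leq_trans n1 nN); rewrite t0 => /lt_le_trans; apply.
by apply: grid_le; rewrite n1.
Qed.

Lemma step_gt0 n : (1 <= n <= N)%N -> 0 < step t n.
Proof.
by case: grid => _ _ tS; case: n => // n nN; rewrite subr_gt0 tS.
Qed.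

Lemma step_s_bounds n : (2 <= n <= N)%N -> 0 <= step_s t n <= 1.
Proof.
case/andP=> n2 nN; have r0 : 0 < step_ratio t n.
  apply: divr_gt0; apply: step_gt0; first by rewrite nN ltnW.
  by case: n n2 nN => // n n2 nN; apply/andP; split=> //; exact: ltnW.
rewrite divr_ge0 ?addr_ge0 ?(ltW r0) //= ler_pdivrMr; lra.
Qed.

Lemma step_le_max n : (2 <= n <= N)%N -> step t n <= step_max t N.
Proof. by move=> nN; apply: le_bigmax_seq => //; rewrite mem_index_iota. Qed.

Lemma sum_step n : (1 <= n)%N -> \sum_(2 <= j < n.+1) step t j = t n - t 1.
Proof.
move=> n1; rewrite big_add1 /= -(telescope_sumr t n1).
by apply: eq_bigr.
Qed.

End Grid.

(** * Linearity of the scheme, giving the equation for the error *)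

Section ErrorEquation.
Context {R : realType} {H : normedModType R}.

Lemma diffB_sub (t : nat -> R) (v U : nat -> H) n :
  Defs.diffB t (fun j => v j - U j) n = Defs.diffB t v n - Defs.diffB t U n.
Proof.
have sub_swap (x y x' y' : H) : x - y - (x' - y') = (x - x') - (y - y').
  by rewrite opprB [y' - x']addrC addrACA opprB [- y + y']addrC.
have dE m : diff1 t (fun j => v j - U j) m = diff1 t v m - diff1 t U m.
  by rewrite /diff1 -scalerBr sub_swap.
by rewrite /Defs.diffB !dE !scalerBr sub_swap.
Qed.

Lemma variational_eq_sub (ip : {dot H for idfun}) (S : operator H)
    w1 w2 x1 x2 b1 b2 g :
  linear_operator S ->
  variational_eq ip S w1 x1 b1 g -> variational_eq ip S w2 x2 b2 g ->
  op_dom S (x1 - x2) /\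
  forall v, op_dom S v ->
    ip (w1 - w2) v + ip (S (x1 - x2)) (S v) + ip (b1 - b2) v = 0.
Proof.
move=> [_ domS linS] [dx1 eq1] [dx2 eq2].
have subE : x1 - x2 = (-1) *: x2 + x1 by rewrite scaleN1r addrC.
split=> [|v dv]; first by rewrite subE; apply: domS.
rewrite subE linS // scaleN1r [- S x2 + _]addrC !linearBl /=.
by have := eq1 v dv; have := eq2 v dv; lra.
Qed.

End ErrorEquation.

Theorem theorem4p1 (R : realType) :
  exists C : R -> R -> R -> R -> R,
  forall (H : completeNormedModType R) (ip : {dot H for idfun})
    (A S : operator H) (B : R -> H -> H) (T : R) (gamma : R -> R) (gmax : R)
    (f : R -> H) (u0 : H) (u du : R -> H)
    (N : nat) (t : nat -> R) (U : nat -> H) (Rbar c1 c4 : R),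
  let e := fun n : nat => u (t n) - U n in
  induces_norm ip ->
  linear_operator A -> dense (op_dom A) -> self_adjoint ip A ->
  positive_definite ip A ->
  is_sqrt ip A S ->
  (forall s, 0 < s <= T -> linear_on (op_dom S) (B s)) ->
  (forall s v, 0 < s <= T -> op_dom S v -> `|B s v| <= gamma s * `|S v|) ->
  smooth_on `]0, T] gamma ->
  (forall s, 0 < s <= T -> 0 <= gamma s) ->
  is_max (gamma @` `]0, T]) gmax ->
  is_solution ip S B f T u0 u du ->
  (2 <= N)%N ->
  time_grid t N T ->
  op_dom S (U 1%N) ->
  bdf2_solution t ip S B f N U ->
  (forall n, (2 <= n <= N)%N ->
    `|consistency_error t u du n| <= c4 * step t n ^+ 2) ->
  1 < Rbar -> Rbar < Num.sqrt 2 + 1 ->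
  ratio_max t N <= Rbar ->
  e 0%N = 0 ->
  (4 + 2 * Num.sqrt 2) * gmax ^+ 2 * step_max t N <= c1 -> c1 < 1 ->
  forall n, (2 <= n <= N)%N ->
    norm_l2 t 2 n e ^+ 2 + norm_linf S 2 n e ^+ 2 <=
      C (t n) gmax c1 c4 *
      (step_max t N ^+ 4 * t n
       + step t 2 / step t 1 ^+ 2 * `|e 1%N| ^+ 2
       + `|S (e 1%N)| ^+ 2).
Proof.
pose K : R := 4 + 2 * Num.sqrt 2.
(* [K] is the inverse Young weight. Division by [1 - c1] comes from absorbing the newest term of the
   sum, the exponential from Gronwall, and the factor 2 from bounding the two norms separately. *)
exists (fun tn g c1 c4 =>
  2 * ((1 + K * c4 ^+ 2) / (1 - c1) * expR (K * g ^+ 2 / (1 - c1) * tn))).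
move=> H ip A S B T gamma gmax f u0 u du N t U Rbar c1 c4 e ip_norm _ _ _ _
  [linS _ _ _ _] linB Bbound _ gamma0 [[s0 s0J gs0] gub] [_ _ sol _]
  N2 grid domU1 bdf cons _ RbarR ratR e0 hc1 c1_lt1.
have q0 : 0 <= Num.sqrt 2 :> R by exact: sqrtr_ge0.
have K0 : 0 < K by rewrite /K; lra.
have gmax0 : 0 <= gmax.
  by rewrite -gs0; apply: gamma0; move: s0J; rewrite /= in_itv.
have kge0 n : (1 <= n <= N)%N -> 0 <= step t n by move/(step_gt0 grid)/ltW.
have step_pred n : (2 <= n <= N)%N -> (1 <= n <= N)%N.
  by case/andP=> n2 ->; rewrite ltnW.
have kmax0 : 0 <= step_max t N.
  by apply: le_trans (step_le_max t (n := 2) _); rewrite ?kge0 ?N2.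
have c1_ge0 : 0 <= c1.
  by apply: le_trans hc1; rewrite !mulr_ge0 ?sqr_ge0 // ltW.
have sub1c : 0 < 1 - c1 by rewrite subr_gt0.
have udom n : (1 <= n <= N)%N -> op_dom S (u (t n)).
  by move=> nN; case: (sol _ (grid_in grid nN)).
have Udom n : (1 <= n <= N)%N -> op_dom S (U n).
  case/andP; rewrite leq_eqVlt => /predU1P[<- //|n2 nN].
  by have [] := bdf n; rewrite ?n2.
have domB x y : op_dom S x -> op_dom S y -> op_dom S (x - y).
  case: linS => _ domS _ dx dy.
  by have := domS (-1) y x dy dx; rewrite scaleN1r addrC.
have edom n : (1 <= n <= N)%N -> op_dom S (e n).
  by move=> nN; apply: domB; [exact: udom | exact: Udom].
have SB x y : op_dom S x -> op_dom S y -> S (x - y) = S x - S y.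
  case: linS => _ _ linS' dx dy.
  by have := linS' (-1) y x dy dx; rewrite !scaleN1r addrC [- _ + _]addrC.
have BB n : (1 <= n <= N)%N ->
    B (t n) (u (t n)) - B (t n) (U n) = B (t n) (e n).
  move=> nN; have := linB _ (grid_in grid nN) (-1) (U n) (u (t n)).
  rewrite !scaleN1r addrC [- _ + _]addrC => -> //; [exact: Udom | exact: udom].
pose a n := `|diff1 t e n| ^+ 2.
pose E n := `|S (e n)| ^+ 2.
pose sigma n := step t n * step_s t n.
(* The right-hand side of [energy_step] once the consistency error is replaced by its bound
   [c4 * step_max t N ^+ 2]. *)
pose F n := step t n * K * (c4 ^+ 2 * step_max t N ^+ 4 + gmax ^+ 2 * E n).
have sigma0 n : (2 <= n <= N)%N -> 0 <= sigma n.
  move=> nN; rewrite mulr_ge0 ?kge0 ?step_pred //.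
  by case/andP: (step_s_bounds grid nN).
have estep n : (2 <= n <= N)%N ->
    (2 * (1 - K^-1) * step t n + sigma n) * a n - sigma n * a n.-1
      + E n - E n.-1 <= F n.
  move=> nN; have n1N := step_pred n nN; have [n2 nN'] := andP nN.
  have pN : (1 <= n.-1 <= N)%N.
    case: (n) n2 nN' => // m m1 mN; apply/andP; split=> //; exact: ltnW.
  have kn0 := step_gt0 grid n1N.
  have tn := grid_in grid n1N.
  have keE : step t n *: diff1 t e n = e n - e n.-1.
    by rewrite scalerA divff ?scale1r // gt_eqF.
  (* The test function [e n - e n.-1] lies in [V] because [n.-1 >= 1]; [e 0] is never tested
     with. *)
  have [_ /(_ _ (domB _ _ (edom _ n1N) (edom _ pN)))] :=
    variational_eq_sub linS (sol _ tn) (bdf n nN).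
  rewrite BB // -/(e n). 
  rewrite (SB _ _ (edom _ n1N) (edom _ pN)) -keE => eqn.
  have duE : du (t n) - Defs.diffB t U n =
      Defs.diffB t e n - consistency_error t u du n.
    have -> : Defs.diffB t e n = Defs.diffB t (u \o t) n - Defs.diffB t U n.
      exact: diffB_sub.
    by rewrite /consistency_error [- (_ - du _)]opprB [RHS]addrC subrKA.
  rewrite duE linearBl -/(e n) /= in eqn.
  have Be : `|B (t n) (e n)| <= gmax * `|S (e n)|.
    apply: le_trans (Bbound _ _ tn (edom _ n1N)) _; apply: ler_wpM2r => //.
    by apply: gub; exists (t n) => //=; rewrite in_itv.
  have sn0 : 0 <= step_s t n by case/andP: (step_s_bounds grid nN).
  have Ki : 0 < K^-1 by rewrite invr_gt0.
  have := @energy_step _ _ ip ip_norm (S (e n)) (S (e n.-1)) (B (t n) (e n))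
    (consistency_error t u du n) (diff1 t e n) (diff1 t e n.-1)
    (step t n) (step_s t n) K^-1 gmax Ki (ltW kn0) sn0 Be.
  rewrite -/(Defs.diffB t e n) invrK => /(_ _)/le_trans; apply; first by lra.
  apply: ler_wpM2l; first by rewrite mulr_ge0 ?ltW.
  rewrite lerD2r; have dc := cons n nN.
  (* The sign of [c4] is not assumed; nonnegativity of the bound follows from its dominating a
     norm. *)
  have d0 : 0 <= c4 * step t n ^+ 2 by apply: le_trans dc.
  have : `|consistency_error t u du n| ^+ 2 <= (c4 * step t n ^+ 2) ^+ 2.
    by rewrite lerXn2r ?nnegrE.
  move/le_trans; apply; rewrite exprMn -exprM ler_wpM2l ?sqr_ge0 //.
  by rewrite lerXn2r ?nnegrE ?(ltW kn0) // step_le_max.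
have sigma_le n : (2 <= n < N)%N ->
    sigma n.+1 <= 2 * (1 - K^-1) * step t n.
  case/andP=> n2 nN; apply: step_ratio_bound.
  - by apply: (step_gt0 grid); rewrite nN.
  - by apply: (step_gt0 grid); rewrite (ltnW n2) ltnW.
  - rewrite addrC; apply: le_trans (ltW RbarR); apply: le_trans ratR.
    apply: (le_bigmax_seq _ (n.+1) _ (step_ratio t)) => //.
    by rewrite mem_index_iota !ltnS (ltnW n2) nN.
have a0 j : 0 <= a j by exact: sqr_ge0.
have esum := energy_sum (fun n _ => a0 n) sigma_le estep.
move=> n nN; have [n2 nN'] := andP nN.
pose D := step_max t N ^+ 4 * t n
  + step t 2 / step t 1 ^+ 2 * `|e 1%N| ^+ 2 + `|S (e 1%N)| ^+ 2.
have tn0 : 0 <= t n by case/andP: (grid_in grid (step_pred n nN)) => /ltW.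
have init0 : 0 <= step t 2 / step t 1 ^+ 2 * `|e 1%N| ^+ 2.
  by rewrite mulr_ge0 ?sqr_ge0 // divr_ge0 ?sqr_ge0 // kge0 // N2.
have D0 : 0 <= D.
  apply: addr_ge0; last exact: sqr_ge0.
  by apply: addr_ge0 => //; rewrite mulr_ge0 ?exprn_ge0.
(* Gronwall is applied to energy plus accumulated surplus, so that one bound on [y] controls both
   norms. *)
pose y l := E l + \sum_(2 <= j < l.+1) sigma j * a j.
have E0 j : 0 <= E j by exact: sqr_ge0.
have Kg0 : 0 <= K * gmax ^+ 2 by apply: mulr_ge0 (ltW K0) (sqr_ge0 _).
have Kc0 : 0 <= K * c4 ^+ 2 by apply: mulr_ge0 (ltW K0) (sqr_ge0 _).
have y_le l : (2 <= l <= n)%N -> y l <= (1 + K * c4 ^+ 2) / (1 - c1) * D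
    + K * gmax ^+ 2 / (1 - c1) * \sum_(2 <= j < l) step t j * y j.
  case/andP=> l2 ln; have lN' := leq_trans ln nN'.
  have lN : (2 <= l <= N)%N by rewrite l2.
  have kl0 : 0 <= step t l by rewrite kge0 ?step_pred.
  have Ki1 : K^-1 <= 1 by rewrite invf_le1 //; rewrite /K; lra.
  have surplus : 0 <= 2 * (1 - K^-1) * step t l * a l.
    by rewrite !mulr_ge0 // subr_ge0.
  (* Here [e 0 = 0] turns the first difference quotient into [e 1 / k_1], and [s_2 <= 1] is
     dropped. *)
  have init : sigma 2 * a 1 <= step t 2 / step t 1 ^+ 2 * `|e 1%N| ^+ 2.
    have -> : a 1%N = (step t 1 ^+ 2)^-1 * `|e 1%N| ^+ 2.
      rewrite /a /diff1 /= e0 subr0 normrZ exprMn; congr (_ * _).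
      by rewrite real_normK ?num_real // exprVn.
    rewrite mulrA ler_wpM2r ?sqr_ge0 // ler_wpM2r ?invr_ge0 ?sqr_ge0 //.
    have /andP[_ s1] := step_s_bounds grid (n := 2) N2.
    by rewrite ler_piMr // kge0 // ltnW.
  have sumF : \sum_(2 <= j < l.+1) F j =
      K * c4 ^+ 2 * step_max t N ^+ 4 * (t l - t 1)
      + K * gmax ^+ 2 * \sum_(2 <= j < l.+1) step t j * E j.
    rewrite -sum_step ?(ltnW l2) // !mulr_sumr -big_split /=.
    by apply: eq_bigr => j _; rewrite /F; ring.
  have tln : t l - t 1 <= t n.
    have /andP[t1 _] := grid_in grid (n := 1) (ltnW N2).
    by have := grid_le grid (i := l) (j := n); rewrite ln => /(_ nN'); lra.
  have consF : K * c4 ^+ 2 * step_max t N ^+ 4 * (t l - t 1)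
      <= K * c4 ^+ 2 * (step_max t N ^+ 4 * t n).
    rewrite -(mulrA (K * c4 ^+ 2)) ler_wpM2l // ler_wpM2l //.
    exact: exprn_ge0.
  (* The summand [j = l] is the implicit one: the step-size restriction bounds it by [c1 * y l],
     which moves to the left and leaves [(1 - c1) * y l]. *)
  have absorb : K * gmax ^+ 2 * (step t l * E l) <= c1 * y l.
    have yl : E l <= y l.
      rewrite lerDl big_nat_cond sumr_ge0 // => j /andP[/andP[j2 jl] _].
      by rewrite mulr_ge0 ?sigma0 // j2 (leq_trans _ lN').
    apply: le_trans (ler_wpM2l c1_ge0 yl); rewrite mulrA ler_wpM2r //.
    apply: le_trans hc1; rewrite -/K ler_wpM2l ?step_le_max //.
  have sumE : \sum_(2 <= j < l) step t j * E j
      <= \sum_(2 <= j < l) step t j * y j.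
    rewrite big_nat_cond [leRHS]big_nat_cond.
    apply: ler_sum => j /andP[/andP[j2 jl] _].
    have jN := leq_trans (ltnW jl) lN'.
    rewrite ler_wpM2l ?kge0 ?(ltnW j2) // lerDl big_nat_cond sumr_ge0 //.
    move=> i /andP[/andP[i2 ij] _].
    by rewrite mulr_ge0 ?sigma0 // i2 (leq_trans _ jN).
  have {}sumE := ler_wpM2l Kg0 sumE.
  (* The starting terms carry coefficient 1 and the consistency term [K * c4 ^+ 2]; these
     nonnegative products, with [kt0], let all of them share the coefficient [1 + K * c4 ^+ 2] of
     [D]. *)
  have initK := mulr_ge0 Kc0 init0; have E1K := mulr_ge0 Kc0 (E0 1%N).
  have kt0 : 0 <= step_max t N ^+ 4 * t n by rewrite mulr_ge0 ?exprn_ge0.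
  have := esum l lN; rewrite sumF.
  rewrite [\sum_(2 <= j < l.+1) (step t j * E j)]big_nat_recr //=.
  rewrite (mulrDr (K * gmax ^+ 2)).
  have yE : y l = E l + \sum_(2 <= j < l.+1) sigma j * a j by [].
  set sumy := \sum_(2 <= j < l) step t j * y j in sumE *.
  have -> : (1 + K * c4 ^+ 2) / (1 - c1) * D + K * gmax ^+ 2 / (1 - c1) * sumy
      = ((1 + K * c4 ^+ 2) * D + K * gmax ^+ 2 * sumy) / (1 - c1) by ring.
  rewrite ler_pdivlMr // => el.
  rewrite /D -/(E 1%N); lra.
have c1inv : 0 <= (1 - c1)^-1 by rewrite invr_ge0 ltW.
have G0 : 0 <= K * gmax ^+ 2 / (1 - c1) by exact: mulr_ge0.
have C0 : 0 <= (1 + K * c4 ^+ 2) / (1 - c1) by rewrite mulr_ge0 // addr_ge0.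
pose M := (1 + K * c4 ^+ 2) / (1 - c1) * D
  * expR (K * gmax ^+ 2 / (1 - c1) * t n).
have kn_ge0 l : (2 <= l <= n)%N -> 0 <= step t l.
  by case/andP=> l2 ln; rewrite kge0 // (ltnW l2) (leq_trans ln).
have yM l : (2 <= l <= n)%N -> y l <= M.
  move=> ln.
  apply: le_trans (discrete_gronwall (mulr_ge0 C0 D0) G0 kn_ge0 y_le ln) _.
  apply: ler_wpM2l; first exact: mulr_ge0.
  rewrite ler_expR; apply: ler_wpM2l => //.
  case/andP: ln => l2 ln.
  (* The steps before [l] add up to [t l.-1 - t 1], which is at most [t n]. *)
  have -> : l = l.-1.+1 by case: (l) l2.
  rewrite sum_step; last by case: (l) l2.
  have /andP[t1 _] := grid_in grid (n := 1) (ltnW N2).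
  have := grid_le grid (i := l.-1) (j := n).
  by rewrite (leq_trans (leq_pred l)) // => /(_ nN'); lra.
have M0 : 0 <= M by exact: mulr_ge0 (mulr_ge0 C0 D0) (expR_ge0 _).
have sum_ge0 l : (2 <= l <= n)%N -> 0 <= \sum_(2 <= j < l.+1) sigma j * a j.
  case/andP=> l2 ln.
  rewrite big_nat_cond sumr_ge0 // => j /andP[/andP[j2 jl] _].
  by rewrite mulr_ge0 ?sigma0 // j2 (leq_trans _ (leq_trans ln nN')).
have l2M : norm_l2 t 2 n e ^+ 2 <= M.
  rewrite sqr_sqrtr.
    apply: le_trans (yM n _); last by rewrite n2 leqnn.
    (* The norm sums only up to [n.-1], so [y n] exceeds its square by [E n] and the summand
       [j = n]. *)
    rewrite /y big_nat_recr //= addrCA lerDl addr_ge0 // mulr_ge0 //.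
    exact: sigma0.
  rewrite big_nat_cond sumr_ge0 // => j /andP[/andP[j2 jn] _].
  by rewrite mulr_ge0 // sigma0 // j2 (leq_trans (ltnW jn)).
have linfM : norm_linf S 2 n e ^+ 2 <= M.
  have : norm_linf S 2 n e <= Num.sqrt M.
    rewrite /norm_linf big_nat_cond.
    apply: bigmax_le => [|j /andP[/andP[j2 jn] _]]; first exact: sqrtr_ge0.
    rewrite -(ler_pXn2r (n := 2)) ?nnegrE ?sqrtr_ge0 // sqr_sqrtr //.
    by apply: le_trans (yM j _); rewrite ?j2 // /y lerDl sum_ge0 // j2.
  move=> h; rewrite -(sqr_sqrtr M0) lerXn2r ?nnegrE ?sqrtr_ge0 //.
  (* Squaring is monotone here because the maximum, with default value 0, is nonnegative. *)
  rewrite /norm_linf; elim/big_ind: _ => // x z x0 _.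
  by rewrite le_max x0.
rewrite -/D; apply: le_trans (lerD l2M linfM) _.
rewrite /M; lra.
Qed.
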